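(* Let $\Omega$ be a semigroup, $(L,\mu,p)$ a Hom-associative algebra with product $x\cdot y$, $\lambda\in\mathbb{K}$, and $\{T_\alpha:L\to L\}_{\alpha\in\Omega}$ a Rota-Baxter family operator of weight $\lambda$. Then $(L,\{\prec_\alpha,\succ_\alpha,\curlyvee_{\alpha,\beta}\}_{\alpha,\beta\in\Omega},p)$ is a Hom-NS-family algebra, where $$x\prec_\alpha y=x\cdot T_\alpha y,\qquad x\succ_\alpha y=T_\alpha x\cdot y,\qquad x\curlyvee_{\alpha,\beta}y=\lambda\,x\cdot y\qquad(x,y\in L,\ \alpha,\beta\in\Omega).$$
   Context: Work over a field $\mathbb{K}$ of characteristic $0$. A Hom-associative algebra $(L,\mu,p)$ is a vector space $L$ with a linear map $p:L\to L$ and a bilinear product $\mu(x,y)=x\cdot y$ such that $p(x\cdot y)=p(x)\cdot p(y)$ and $p(x)\cdot(y\cdot z)=(x\cdot y)\cdot p(z)$. A Rota-Baxter family operator of weight $\lambda$ on $(L,\mu,p)$ is a collection of linear maps $\{T_\alpha:L\to L\}_{\alpha\in\Omega}$ with $p(T_\alpha x)=T_\alpha p(x)$ and $T_\alpha x\cdot T_\beta y=T_{\alpha\beta}(T_\alpha x\cdot y+x\cdot T_\beta y+\lambda x\cdot y)$ for all $x,y\in L$, $\alpha,\beta\in\Omega$. A Hom-NS-family algebra $(G,\{\prec_\alpha,\succ_\alpha,\curlyvee_{\alpha,\beta}\}_{\alpha,\beta\in\Omega},p)$ is a vector space $G$ with bilinear operations $\prec_\alpha,\succ_\alpha,\curlyvee_{\alpha,\beta}:G\times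 G\to G$ and a linear map $p:G\to G$ preserving each operation such that for all $x,y,z\in G$, $\alpha,\beta,\gamma\in\Omega$: $p(x)\prec_{\alpha\beta}(y\prec_\beta z+y\succ_\alpha z+y\curlyvee_{\alpha,\beta}z)=(x\prec_\alpha y)\prec_\beta p(z)$; $(x\succ_\alpha y)\prec_\beta p(z)=p(x)\succ_\alpha(y\prec_\beta z)$; $(x\prec_\beta y+x\succ_\alpha y+x\curlyvee_{\alpha,\beta}y)\succ_{\alpha\beta}p(z)=p(x)\succ_\alpha(y\succ_\beta z)$; $p(x)\succ_\alpha(y\curlyvee_{\beta,\gamma}z)+p(x)\curlyvee_{\alpha,\beta\gamma}(y\prec_\gamma z+y\succ_\beta z+y\curlyvee_{\beta,\gamma}z)=(x\curlyvee_{\alpha,\beta}y)\prec_\gamma p(z)+(x\prec_\beta y+x\succ_\alpha y+x\curlyvee_{\alpha,\beta}y)\curlyvee_{\alpha\beta,\gamma}p(z)$. *)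

(* Defs.v *)
From mathcomp Require Import all_boot all_algebra.

Set Implicit Arguments.
Unset Strict Implicit.
Unset Printing Implicit Defensive.

Import GRing.Theory.
Local Open Scope ring_scope.

Record hom_associative (K : fieldType) (L : lmodType K)
    (mu : L -> L -> L) (p : L -> L) : Prop := HomAssociative {
  hom_associative_linear : linear p;
  hom_associative_bilinear : bilinear_for *:%R *:%R mu;
  hom_associative_morph : {morph p : x y / mu x y};
  hom_associativity : forall x y z, mu (p x) (mu y z) = mu (mu x y) (p z)
}.

Record rota_baxter_family (K : fieldType) (L : lmodType K) (Omega : semigroupType)
    (lambda : K) (mu : L -> L -> L) (p : L -> L) (T : Omega -> L -> L)
    : Prop := RotaBaxterFamily {
  rota_baxter_linear : forall a, linear (T a);
  rota_baxter_comm : forall a x, p (T a x) = T a (p x);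
  rota_baxter_identity : forall a b x y,
    mu (T a x) (T b y) =
    T (a * b)%g (mu (T a x) y + mu x (T b y) + lambda *: mu x y)
}.

(* [prec a], [succ a] and [vee a b] are $\prec_\alpha$, $\succ_\alpha$ and
   $\curlyvee_{\alpha,\beta}$. Note the crossed indices in [ns_star a b]:
   $\prec$ takes the second index and $\succ$ the first. *)
Definition ns_star (G : zmodType) (Omega : Type)
    (prec succ : Omega -> G -> G -> G) (vee : Omega -> Omega -> G -> G -> G)
    (a b : Omega) (x y : G) : G :=
  prec b x y + succ a x y + vee a b x y.

Record hom_NS_family (K : fieldType) (G : lmodType K) (Omega : semigroupType)
    (prec succ : Omega -> G -> G -> G) (vee : Omega -> Omega -> G -> G -> G)
    (p : G -> G) : Prop := HomNSFamily {
  NS_prec_bilinear : forall a, bilinear_for *:%R *:%R (prec a);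
  NS_succ_bilinear : forall a, bilinear_for *:%R *:%R (succ a);
  NS_vee_bilinear : forall a b, bilinear_for *:%R *:%R (vee a b);
  NS_linear : linear p;
  NS_prec_morph : forall a, {morph p : x y / prec a x y};
  NS_succ_morph : forall a, {morph p : x y / succ a x y};
  NS_vee_morph : forall a b, {morph p : x y / vee a b x y};
  NS_prec_prec : forall a b x y z,
    prec (a * b)%g (p x) (ns_star prec succ vee a b y z) =
    prec b (prec a x y) (p z);
  NS_succ_prec : forall a b x y z,
    prec b (succ a x y) (p z) = succ a (p x) (prec b y z);
  NS_succ_succ : forall a b x y z,
    succ (a * b)%g (ns_star prec succ vee a b x y) (p z) =
    succ a (p x) (succ b y z);
  NS_vee : forall a b c x y z,
    succ a (p x) (vee b c y z)
      + vee a (b * c)%g (p x) (ns_star prec succ vee b c y z) =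
    prec c (vee a b x y) (p z)
      + vee (a * b)%g c (ns_star prec succ vee a b x y) (p z)
}.

(* Main.v *)
(* The Rota-Baxter identity says that the sum of the three products of [x] and
   [y] is sent by [T (a * b)] to [mu (T a x) (T b y)]; as [p] commutes with each
   [T a], every axiom then becomes an instance of Hom-associativity. *)
Require Import Defs.
From mathcomp Require Import all_boot all_algebra.
Set Implicit Arguments.
Unset Strict Implicit.
Unset Printing Implicit Defensive.
Import GRing.Theory.
Local Open Scope ring_scope.

Theorem corollary3p11 (K : fieldType) (charK0 : [pchar K] =i pred0)
    (Omega : semigroupType) (L : lmodType K) (mu : L -> L -> L) (p : L -> L)
    (homL : hom_associative mu p) (lambda : K) (T : Omega -> L -> L)
    (rbT : rota_baxter_family lambda mu p T) :
  hom_NS_family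
    (fun (a : Omega) (x y : L) => mu x (T a y))
    (fun (a : Omega) (x y : L) => mu (T a x) y)
    (fun (_ _ : Omega) (x y : L) => lambda *: mu x y)
    p.
Proof.
have [linp [/= mul_l mul_r] pM muA] := homL.
have [linT Tp rb] := rbT.
(* Bilinearity is one law for [k *: x + y]: [k = 1] isolates additivity, a zero summand
   homogeneity. *)
have muD_l x y z : mu (x + y) z = mu x z + mu y z.
  by have := mul_l z 1 x y; rewrite !scale1r.
have muD_r x y z : mu x (y + z) = mu x y + mu x z.
  by have := mul_r x 1 y z; rewrite !scale1r.
have mu0_l x : mu 0 x = 0 by apply: (@addrI _ (mu 0 x)); rewrite -muD_l !addr0.
have mu0_r x : mu x 0 = 0 by apply: (@addrI _ (mu x 0)); rewrite -muD_r !addr0.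
have muZ_l k x y : mu (k *: x) y = k *: mu x y.
  by have := mul_l y k x 0; rewrite mu0_l !addr0.
have muZ_r k x y : mu x (k *: y) = k *: mu x y.
  by have := mul_r x k y 0; rewrite mu0_r !addr0.
have pZ k x : p (k *: x) = k *: p x.
  have p0 : p 0 = 0.
    (* The scalar [-1] gives [p 0 = - p 0 + p 0]. *)
    by have := linp (- 1) 0 0; rewrite scaler0 addr0 scaleN1r addNr.
  by have := linp k x 0; rewrite p0 !addr0.
(* The summands follow the order of [ns_star]. *)
have Tstar a b x y :
    T (a * b)%g (mu x (T b y) + mu (T a x) y + lambda *: mu x y) =
    mu (T a x) (T b y).
  by rewrite [mu x _ + _]addrC rb.
split=> //=.
- move=> a; split=> [y|x] k u v /=; first exact: mul_l.
  by rewrite linT mul_r.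
- move=> a; split=> [y|x] k u v /=; last exact: mul_r.
  by rewrite linT mul_l.
- move=> _ _; split=> [y|x] k u v /=.
    by rewrite mul_l scalerDr !scalerA mulrC.
  by rewrite mul_r scalerDr !scalerA mulrC.
- by move=> a x y; rewrite pM Tp.
- by move=> a x y; rewrite pM Tp.
- by move=> _ _ x y; rewrite pZ pM.
(* Hom-associativity at [x], [T a y], [T b z]; then at [T a x], [y], [T b z], and at [T a x],
   [T b y], [z]. *)
- by move=> a b x y z; rewrite /ns_star Tstar muA Tp.
- by move=> a b x y z; rewrite -Tp -Tp muA.
- by move=> a b x y z; rewrite /ns_star Tstar -Tp muA.
(* Both sides expand into four triple products: [lambda] times those with [T] on exactly one of [x],
   [y], [z], and [lambda * lambda] times the one without [T]. *)
- move=> a b c x y z; rewrite /ns_star -!Tp !muZ_r !muZ_l.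
  rewrite !muD_r !muD_l !muZ_r !muZ_l !muA !scalerDr.
  by rewrite addrCA !addrA addrAC; congr (_ + _); rewrite addrAC.
Qed.
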